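(* Let $H$ be a weak Hopf algebra with antipode $S$ over a field $\mathbf{k}$, and $A$ a weak right $H$-comodule algebra. Let $\phi:H\to A$ be a weak right $H$-comodule algebra map and let $M$ be a weak right $(A,H)$-Doi-Hopf module. Define $$E_A:A\to A,\quad E_A(a)=a_{(0)}\,\phi(S(a_{(1)}))\quad\text{for all } a\in A,$$ $$E_M:M\to M,\quad E_M(m)=m_{(0)}\cdot\phi(S(m_{(1)}))\quad\text{for all } m\in M.$$ Then $(M,E_A,E_M)$ is a right Rota-Baxter paired $A$-module of weight $-1$.
   Context: Sweedler notation: $\Delta(h)=h_1\otimes h_2$, $\Delta(1_H)=1_1\otimes 1_2$, and right coactions are written $\rho(m)=m_{(0)}\otimes m_{(1)}$. A weak bialgebra over $\mathbf{k}$ is a $\mathbf{k}$-vector space $H$ that is both a (unital associative) algebra and a (counital coassociative) coalgebra such that for all $x,y,z\in H$: (i) $\Delta(xy)=\Delta(x)\Delta(y)$; (ii) $\varepsilon(xyz)=\varepsilon(xy_1)\varepsilon(y_2z)=\varepsilon(xy_2)\varepsilon(y_1z)$; (iii) $\Delta^2(1_H)=(\Delta(1_H)\otimes 1_H)(1_H\otimes\Delta(1_H))=(1_H\otimes\Delta(1_H))(\Delta(1_H)\otimes 1_H)$, where $\Delta^2=(\Delta\otimes\mathrm{id}_H)\circ\Delta$. Put $\Pi^L(h)=\varepsilon(1_1h)1_2$ and $\Pi^R(h)=\varepsilon(h1_2)1_1$. A weak Hopf algebra is a weak bialgebra with a linear map $S:H\to H$ (the antipode) such that $x_1S(x_2)=\Pi^L(x)$,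 $S(x_1)x_2=\Pi^R(x)$ and $S(x_1)x_2S(x_3)=S(x)$ for all $x\in H$. A weak right $H$-comodule algebra is a unital $\mathbf{k}$-algebra $A$ that is a right $H$-comodule via $\rho:A\to A\otimes H$ (so $(\rho\otimes\mathrm{id}_H)\rho=(\mathrm{id}_A\otimes\Delta)\rho$ and $(\mathrm{id}_A\otimes\varepsilon)\rho=\mathrm{id}_A$) such that for all $a,b\in A$: $\rho(1_A)(a\otimes 1_H)=(\mathrm{id}_A\otimes\Pi^L)\rho(a)$ and $\rho(ab)=\rho(a)\rho(b)$. In particular $H$ is a weak right $H$-comodule algebra via $\Delta$. A weak right $H$-comodule algebra map $\phi:H\to A$ is a (unital) algebra homomorphism that is also a right $H$-comodule map, i.e. $\rho(\phi(h))=\phi(h_1)\otimes h_2$. A weak right $(A,H)$-Doi-Hopf module is a $\mathbf{k}$-module $M$ that is both a right $A$-module and a right $H$-comodule with structure map $\rho_M$ such that $\rho_M(m\cdot a)=m_{(0)}\cdot a_{(0)}\otimes m_{(1)}a_{(1)}$ for all $a\in A$, $m\in M$. For an algebra $A$, a right $A$-module $M$ and $\mathbf{k}$-linear maps $P:A\to A$, $T:M\to M$, the triple $(M,P,T)$ is a right Rota-Baxter paired $A$-module of weight $\lambda\in\mathbf{k}$ if $$T(m)\cdot P(a)=T(m\cdot P(a))+T(T(m)\cdot a)+\lambda T(m\cdot a)\quad\text{for all } a\in A,\ m\in M.$$ *)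

(* Defs.v *)
From HB Require Import structures.
From mathcomp Require Import all_boot all_order all_algebra.
From mathcomp Require Import boolp.

Set Implicit Arguments.
Unset Strict Implicit.
Unset Printing Implicit Defensive.

Import GRing.Theory.
Local Open Scope ring_scope.
Local Open Scope quotient_scope.

Reserved Notation "u ⊗ v" (at level 40, left associativity).
Reserved Notation "x ∙ y" (at level 40, left associativity).
Reserved Notation "m ◁ a" (at level 40, left associativity).

Section Tensor.
Variables (K : fieldType) (U V : lmodType K).

(* The sequence [:: (u1, v1); ...; (un, vn)] stands for the formal sum
   u1 ⊗ v1 + ... + un ⊗ vn; [tensor_eq] is the least congruence making it
   biadditive and K-balanced. *)
Inductive tensor_eq : seq (U * V) -> seq (U * V) -> Prop :=
| tensor_eq_refl s : tensor_eq s s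
| tensor_eq_sym s t : tensor_eq s t -> tensor_eq t s
| tensor_eq_trans s t r : tensor_eq s t -> tensor_eq t r -> tensor_eq s r
| tensor_eq_cat s s' t t' :
    tensor_eq s s' -> tensor_eq t t' -> tensor_eq (s ++ t) (s' ++ t')
| tensor_eq_catC s t : tensor_eq (s ++ t) (t ++ s)
| tensor_eq_addl u u' v : tensor_eq [:: (u + u', v)] [:: (u, v); (u', v)]
| tensor_eq_addr u v v' : tensor_eq [:: (u, v + v')] [:: (u, v); (u, v')]
| tensor_eq_scale a u v : tensor_eq [:: (a *: u, v)] [:: (u, a *: v)]
| tensor_eq_0 v : tensor_eq [:: (0, v)] [::].

Definition tensor_rel (s t : seq (U * V)) : bool := `[< tensor_eq s t >].

Lemma tensor_rel_refl : reflexive tensor_rel.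
Proof. by move=> s; apply/asboolP; exact: tensor_eq_refl. Qed.

Lemma tensor_rel_sym : symmetric tensor_rel.
Proof.
by move=> s t; apply/asboolP/asboolP => h; exact: tensor_eq_sym.
Qed.

Lemma tensor_rel_trans : transitive tensor_rel.
Proof.
move=> s t r /asboolP h /asboolP h'; apply/asboolP.
exact: tensor_eq_trans h h'.
Qed.

Canonical tensor_equiv :=
  EquivRel tensor_rel tensor_rel_refl tensor_rel_sym tensor_rel_trans.

Definition tensor := {eq_quot tensor_equiv}.

HB.instance Definition _ := Choice.on tensor.
HB.instance Definition _ := EqQuotient.on tensor.

Lemma tensor_piP (s t : seq (U * V)) :
  reflect (\pi_tensor s = \pi_tensor t) `[< tensor_eq s t >].
Proof.
apply: (iffP idP) => [h|h]; first by apply/eqmodP.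
by move/eqmodP: h.
Qed.

Lemma tensor_repr_pi (s : seq (U * V)) : tensor_eq (repr (\pi_tensor s)) s.
Proof. by apply/asboolP/tensor_piP; rewrite reprK. Qed.

Definition tensor_zero : tensor := \pi_tensor [::].
Definition tensor_add (x y : tensor) : tensor :=
  \pi_tensor (repr x ++ repr y).
Definition tensor_scale (a : K) (x : tensor) : tensor :=
  \pi_tensor [seq (a *: p.1, p.2) | p <- repr x].

Definition pure (u : U) (v : V) : tensor := \pi_tensor [:: (u, v)].

Lemma tensor_add_pi (s t : seq (U * V)) :
  tensor_add (\pi_tensor s) (\pi_tensor t) = \pi_tensor (s ++ t).
Proof.
apply/tensor_piP/asboolP.
by apply: tensor_eq_cat; exact: tensor_repr_pi.
Qed.

Lemma tensor_scale_pi a (s : seq (U * V)) :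
  tensor_scale a (\pi_tensor s) = \pi_tensor [seq (a *: p.1, p.2) | p <- s].
Proof.
apply/tensor_piP/asboolP.
move: (tensor_repr_pi s); set r := repr _; elim => //=.
- by move=> *; exact: tensor_eq_refl.
- by move=> *; exact: tensor_eq_sym.
- by move=> ? ? ? _ h _ h'; exact: tensor_eq_trans h h'.
- by move=> *; rewrite !map_cat; exact: tensor_eq_cat.
- by move=> *; rewrite !map_cat; exact: tensor_eq_catC.
- by move=> *; rewrite scalerDr; exact: tensor_eq_addl.
- by move=> *; exact: tensor_eq_addr.
- move=> b u v; rewrite scalerA mulrC -scalerA; exact: tensor_eq_scale.
- by move=> v; rewrite scaler0; exact: tensor_eq_0.
Qed.

Lemma tensor_addA : associative tensor_add.
Proof.
elim/quotW=> x; elim/quotW=> y; elim/quotW=> z.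
by rewrite (tensor_add_pi y z) (tensor_add_pi x y) !tensor_add_pi catA.
Qed.

Lemma tensor_addC : commutative tensor_add.
Proof.
elim/quotW=> x; elim/quotW=> y; rewrite !tensor_add_pi.
apply/tensor_piP/asboolP; exact: tensor_eq_catC.
Qed.

Lemma tensor_add0 : left_id tensor_zero tensor_add.
Proof. by elim/quotW=> x; rewrite tensor_add_pi. Qed.

HB.instance Definition _ :=
  GRing.isNmodule.Build tensor tensor_addA tensor_addC tensor_add0.

Lemma tensor_addE (s t : seq (U * V)) :
  \pi_tensor (s ++ t) = \pi_tensor s + \pi_tensor t.
Proof. by rewrite -tensor_add_pi. Qed.

Lemma tensor_piE (s : seq (U * V)) :
  \pi_tensor s = \sum_(p <- s) pure p.1 p.2.
Proof.
elim: s => [|[u v] s IHs]; first by rewrite big_nil.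
by rewrite big_cons -IHs -cat1s tensor_addE.
Qed.

Lemma tensor_ind (P : tensor -> Prop) :
    P 0 -> (forall u v, P (pure u v)) ->
    (forall x y, P x -> P y -> P (x + y)) ->
  forall x, P x.
Proof.
move=> P0 Pp PD x; rewrite -[x]reprK tensor_piE.
by elim/big_ind: _.
Qed.

Lemma pureDl u u' v : pure (u + u') v = pure u v + pure u' v.
Proof.
rewrite /pure -tensor_addE; apply/tensor_piP/asboolP.
exact: tensor_eq_addl.
Qed.

Lemma pureDr u v v' : pure u (v + v') = pure u v + pure u v'.
Proof.
rewrite /pure -tensor_addE; apply/tensor_piP/asboolP.
exact: tensor_eq_addr.
Qed.

Lemma pureZ a u v : pure (a *: u) v = pure u (a *: v).
Proof. by apply/tensor_piP/asboolP; exact: tensor_eq_scale. Qed.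

Lemma pure0l v : pure 0 v = 0.
Proof. by apply/tensor_piP/asboolP; exact: tensor_eq_0. Qed.

Lemma pure0r u : pure u 0 = 0.
Proof. by rewrite -(scaler0 _ 0) -pureZ scale0r pure0l. Qed.

Lemma tensor_scale_pure a u v : tensor_scale a (pure u v) = pure (a *: u) v.
Proof. by rewrite tensor_scale_pi. Qed.

Lemma tensor_scaleDr a : {morph tensor_scale a : x y / x + y}.
Proof.
elim/quotW=> x; elim/quotW=> y; rewrite -tensor_addE !tensor_scale_pi.
by rewrite map_cat tensor_addE.
Qed.

Lemma tensor_scale0 a : tensor_scale a 0 = 0.
Proof. exact: tensor_scale_pi. Qed.

Lemma tensor_addN : left_inverse 0 (tensor_scale (-1)) +%R.
Proof.
elim/tensor_ind => [|u v|x y hx hy].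
- by rewrite tensor_scale0 addr0.
- by rewrite tensor_scale_pure -pureDl scaleN1r addNr pure0l.
- by rewrite tensor_scaleDr addrACA hx hy addr0.
Qed.

HB.instance Definition _ := GRing.Nmodule_isZmodule.Build tensor tensor_addN.

Lemma tensor_scaleA a b x :
  tensor_scale a (tensor_scale b x) = tensor_scale (a * b) x.
Proof.
elim/tensor_ind: x => [|u v|x y hx hy].
- by rewrite !tensor_scale0.
- by rewrite !tensor_scale_pure scalerA.
- by rewrite !tensor_scaleDr hx hy.
Qed.

Lemma tensor_scale1 : left_id 1 tensor_scale.
Proof.
elim/tensor_ind => [|u v|x y hx hy].
- by rewrite tensor_scale0.
- by rewrite tensor_scale_pure scale1r.
- by rewrite tensor_scaleDr hx hy.
Qed.

Lemma tensor_scaleDl x : {morph tensor_scale^~ x : a b / a + b}.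
Proof.
move=> a b; elim/tensor_ind: x => [|u v|x y hx hy].
- by rewrite !tensor_scale0 addr0.
- by rewrite !tensor_scale_pure scalerDl pureDl.
- by rewrite !tensor_scaleDr hx hy addrACA.
Qed.

HB.instance Definition _ := GRing.Zmodule_isLmodule.Build K tensor
  tensor_scaleA tensor_scale1 tensor_scaleDr tensor_scaleDl.

Lemma pureZl a u v : pure (a *: u) v = a *: pure u v.
Proof. by rewrite -tensor_scale_pure. Qed.

Lemma pureZr a u v : pure u (a *: v) = a *: pure u v.
Proof. by rewrite -pureZ pureZl. Qed.

Definition balanced (W : zmodType) (f : U -> V -> W) : Prop :=
  [/\ forall u u' v, f (u + u') v = f u v + f u' v,
      forall u v v', f u (v + v') = f u v + f u v'
    & forall a u v, f (a *: u) v = f u (a *: v)].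

(* [tlift f (\sum_i u_i ⊗ v_i) = \sum_i f u_i v_i]; it is independent of the
   representative when [f] is balanced, see [tlift_pure] and [tliftD].  With
   [t = Δ h] this is the Sweedler notation [f h_1 h_2]. *)
Definition tlift (W : zmodType) (f : U -> V -> W) (t : tensor) : W :=
  \sum_(p <- repr t) f p.1 p.2.

Lemma tlift_pi (W : zmodType) (f : U -> V -> W) (s : seq (U * V)) :
  balanced f -> tlift f (\pi_tensor s) = \sum_(p <- s) f p.1 p.2.
Proof.
case=> fDl fDr fZ; rewrite /tlift.
move: (tensor_repr_pi s); set r := repr _; elim => //.
- by move=> ? ? ? _ h _ h'; rewrite h.
- by move=> ? ? ? ? _ h _ h'; rewrite !big_cat /= h h'.
- by move=> ? ?; rewrite !big_cat /= addrC.
- by move=> *; rewrite !big_cons !big_nil /= !addr0.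
- by move=> *; rewrite !big_cons !big_nil /= !addr0.
- by move=> *; rewrite !big_cons !big_nil /= !addr0.
- move=> v; rewrite big_cons !big_nil /= addr0.
  by apply: (addrI (f 0 v)); rewrite -fDl !addr0.
Qed.

Lemma tlift_pure (W : zmodType) (f : U -> V -> W) u v :
  balanced f -> tlift f (pure u v) = f u v.
Proof. by move=> bf; rewrite tlift_pi // big_cons big_nil addr0. Qed.

Lemma tliftD (W : zmodType) (f : U -> V -> W) :
  balanced f -> {morph tlift f : x y / x + y}.
Proof.
move=> bf; elim/quotW=> x; elim/quotW=> y; rewrite -tensor_addE !tlift_pi //.
by rewrite big_cat.
Qed.

Lemma tlift0 (W : zmodType) (f : U -> V -> W) : balanced f -> tlift f 0 = 0.
Proof. by move=> bf; rewrite tlift_pi // big_nil. Qed.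

Lemma tliftZ (W : lmodType K) (f : U -> V -> W) a t :
    balanced f -> (forall u v, f (a *: u) v = a *: f u v) ->
  tlift f (a *: t) = a *: tlift f t.
Proof.
move=> bf fZ; elim/tensor_ind: t => [|u v|x y hx hy].
- by rewrite scaler0 tlift0 // scaler0.
- by rewrite -pureZl !tlift_pure.
- by rewrite scalerDr !tliftD // scalerDr hx hy.
Qed.

Lemma tlift_unique (W : zmodType) (f : U -> V -> W) (g : tensor -> W) :
    balanced f -> {morph g : x y / x + y} ->
    (forall u v, g (pure u v) = f u v) ->
  g =1 tlift f.
Proof.
move=> bf gD gp; elim/tensor_ind => [|u v|x y hx hy].
- rewrite tlift0 //.
  by apply: (addrI (g 0)); rewrite -gD !addr0.
- by rewrite gp tlift_pure.
- by rewrite gD tliftD // hx hy.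
Qed.

Lemma eq_tlift (W : zmodType) (f g : U -> V -> W) t :
  (forall u v, f u v = g u v) -> tlift f t = tlift g t.
Proof. by move=> fg; apply: eq_bigr => p _; exact: fg. Qed.

Lemma tlift_addf (W : zmodType) (f g : U -> V -> W) t :
  tlift (fun u v => f u v + g u v) t = tlift f t + tlift g t.
Proof. exact: big_split. Qed.

Lemma tlift_additive (W W' : zmodType) (f : U -> V -> W) (h : W -> W') t :
    {morph h : x y / x + y} ->
  h (tlift f t) = tlift (fun u v => h (f u v)) t.
Proof.
move=> hD; apply: (big_morph h) => //.
by apply: (addrI (h 0)); rewrite -hD !addr0.
Qed.

End Tensor.

Arguments tensor {K} U V.
Arguments pure {K U V} u v : simpl never.
Arguments tlift {K U V W} f t : simpl never.
Notation "U ⊗ V" := (tensor U V) : type_scope.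
Notation "u ⊗ v" := (pure u v) : ring_scope.

Section TensorMaps.
Variable K : fieldType.

Definition tmap (U U' V V' : lmodType K) (f : U -> U') (g : V -> V') :
  (U ⊗ V)%type -> (U' ⊗ V')%type := tlift (fun u v => f u ⊗ g v).

Definition tassoc (U V W : lmodType K) :
  (U ⊗ (V ⊗ W))%type -> (U ⊗ V ⊗ W)%type :=
  tlift (fun u => tlift (fun v w => u ⊗ v ⊗ w)).

Lemma pure_balanced (U V : lmodType K) : balanced (@pure K U V).
Proof. by split; [exact: pureDl | exact: pureDr | exact: pureZ]. Qed.

Lemma tmap_balanced (U U' V V' : lmodType K)
    (f : {linear U -> U'}) (g : {linear V -> V'}) :
  balanced (fun u v => f u ⊗ g v).
Proof.
split=> *; rewrite ?linearD ?linearZ /=.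
- exact: pureDl.
- exact: pureDr.
- exact: pureZ.
Qed.

Lemma tmap_pure (U U' V V' : lmodType K)
    (f : {linear U -> U'}) (g : {linear V -> V'}) u v :
  tmap f g (u ⊗ v) = f u ⊗ g v.
Proof. exact/tlift_pure/tmap_balanced. Qed.

Lemma tassoc_inner_balanced (U V W : lmodType K) (u : U) :
  balanced (fun (v : V) (w : W) => u ⊗ v ⊗ w).
Proof.
split=> *; first by rewrite pureDr pureDl.
- by rewrite pureDr.
- by rewrite pureZr pureZ.
Qed.

Lemma tassoc_balanced (U V W : lmodType K) :
  balanced (fun u : U => tlift (fun (v : V) (w : W) => u ⊗ v ⊗ w)).
Proof.
split=> [u u' t|u t t'|a u t].
- by rewrite -tlift_addf; apply: eq_tlift => v w; rewrite !pureDl.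
- exact/tliftD/tassoc_inner_balanced.
- rewrite tliftZ; last 2 first.
  + exact: tassoc_inner_balanced.
  + by move=> v w; rewrite pureZr pureZl.
  rewrite (@tlift_additive _ _ _ _ _ _ ( *:%R a)); last exact: scalerDr.
  by apply: eq_tlift => v w; rewrite !pureZl.
Qed.

Lemma tassoc_pure (U V W : lmodType K) (u : U) (v : V) (w : W) :
  tassoc (u ⊗ (v ⊗ w)) = u ⊗ v ⊗ w.
Proof.
rewrite /tassoc tlift_pure; last exact: tassoc_balanced.
exact/tlift_pure/tassoc_inner_balanced.
Qed.

End TensorMaps.

(* Unlike [algType K], which excludes the zero algebra, this allows it. *)
HB.mixin Record Lmodule_isUAlgebra (K : fieldType) A of GRing.Lmodule K A := {
  amul : {bilinear A -> A -> A};
  aone : A;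
  amulA : forall x y z : A, amul x (amul y z) = amul (amul x y) z;
  amul1l : forall x : A, amul aone x = x;
  amul1r : forall x : A, amul x aone = x
}.

#[short(type="ualgType")]
HB.structure Definition UAlgebra (K : fieldType) :=
  {A of GRing.Lmodule K A & Lmodule_isUAlgebra K A}.

Notation "x ∙ y" := (amul x y) : ring_scope.

Section UAlgebraTheory.
Variables (K : fieldType) (A : ualgType K).
Implicit Types x y z : A.

Lemma amulDl x y z : (x + y) ∙ z = x ∙ z + y ∙ z.
Proof. exact: linearDl. Qed.

Lemma amulDr x y z : x ∙ (y + z) = x ∙ y + x ∙ z.
Proof. exact: linearDr. Qed.

Lemma amulZl a x y : (a *: x) ∙ y = a *: (x ∙ y).
Proof. exact: linearZl_LR. Qed.

Lemma amulZr a x y : x ∙ (a *: y) = a *: (x ∙ y).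
Proof. exact: linearZr_LR. Qed.

End UAlgebraTheory.

Section AlgebraIsUAlgebra.
Variables (K : fieldType) (A : algType K).

Definition alg_mul (x y : A) : A := x * y.

Lemma alg_mul_bilinear : bilinear_for *:%R *:%R alg_mul.
Proof.
split=> [z|z] a x y /=; rewrite /alg_mul; first by rewrite mulrDl scalerAl.
by rewrite mulrDr scalerAr.
Qed.

HB.instance Definition _ :=
  bilinear_isBilinear.Build K A A A *:%R *:%R alg_mul alg_mul_bilinear.

Lemma alg_mulA x y z : alg_mul x (alg_mul y z) = alg_mul (alg_mul x y) z.
Proof. exact: mulrA. Qed.

Lemma alg_mul1l x : alg_mul 1 x = x.
Proof. exact: mul1r. Qed.

Lemma alg_mul1r x : alg_mul x 1 = x.
Proof. exact: mulr1. Qed.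

HB.instance Definition _ :=
  Lmodule_isUAlgebra.Build K A alg_mulA alg_mul1l alg_mul1r.

End AlgebraIsUAlgebra.

Section TensorAlgebra.
Variables (K : fieldType) (A B : ualgType K).

Definition tensor_mul (x y : A ⊗ B) : A ⊗ B :=
  tlift (fun a b => tlift (fun a' b' => (a ∙ a') ⊗ (b ∙ b')) y) x.

Lemma tensor_mul_inner_balanced (a : A) (b : B) :
  balanced (fun a' b' => (a ∙ a') ⊗ (b ∙ b')).
Proof.
split=> *.
- by rewrite amulDr pureDl.
- by rewrite amulDr pureDr.
- by rewrite !amulZr pureZ.
Qed.

Lemma tensor_mul_balanced (y : A ⊗ B) :
  balanced (fun a b => tlift (fun a' b' => (a ∙ a') ⊗ (b ∙ b')) y).
Proof.
split=> [u u' v|u v v'|c u v].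
- by rewrite -tlift_addf; apply: eq_tlift => *; rewrite amulDl pureDl.
- by rewrite -tlift_addf; apply: eq_tlift => *; rewrite amulDl pureDr.
- by apply: eq_tlift => *; rewrite !amulZl pureZ.
Qed.

Lemma tensor_mul_pure a b a' b' :
  tensor_mul (a ⊗ b) (a' ⊗ b') = (a ∙ a') ⊗ (b ∙ b').
Proof.
rewrite /tensor_mul tlift_pure; last exact: tensor_mul_balanced.
exact/tlift_pure/tensor_mul_inner_balanced.
Qed.

Lemma tensor_mulDl x y z :
  tensor_mul (x + y) z = tensor_mul x z + tensor_mul y z.
Proof. exact/tliftD/tensor_mul_balanced. Qed.

Lemma tensor_mulDr x y z :
  tensor_mul x (y + z) = tensor_mul x y + tensor_mul x z.
Proof.
rewrite /tensor_mul -tlift_addf; apply: eq_tlift => a b.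
exact/tliftD/tensor_mul_inner_balanced.
Qed.

Lemma tensor_mul0l x : tensor_mul 0 x = 0.
Proof. exact/tlift0/tensor_mul_balanced. Qed.

Lemma tensor_mul0r x : tensor_mul x 0 = 0.
Proof.
by apply: (addrI (tensor_mul x 0)); rewrite -tensor_mulDr !addr0.
Qed.

Lemma tensor_mulZl c x y : tensor_mul (c *: x) y = c *: tensor_mul x y.
Proof.
elim/tensor_ind: x => [|a b|x x' hx hx'].
- by rewrite scaler0 tensor_mul0l scaler0.
- elim/tensor_ind: y => [|a' b'|y y' hy hy'].
  + by rewrite !tensor_mul0r scaler0.
  + by rewrite -pureZl !tensor_mul_pure amulZl pureZl.
  + by rewrite !tensor_mulDr scalerDr hy hy'.
- by rewrite scalerDr !tensor_mulDl scalerDr hx hx'.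
Qed.

Lemma tensor_mulZr c x y : tensor_mul x (c *: y) = c *: tensor_mul x y.
Proof.
elim/tensor_ind: y => [|a' b'|y y' hy hy'].
- by rewrite scaler0 tensor_mul0r scaler0.
- elim/tensor_ind: x => [|a b|x x' hx hx'].
  + by rewrite !tensor_mul0l scaler0.
  + by rewrite -pureZl !tensor_mul_pure amulZr pureZl.
  + by rewrite !tensor_mulDl scalerDr hx hx'.
- by rewrite scalerDr !tensor_mulDr scalerDr hy hy'.
Qed.

Lemma tensor_mulA x y z :
  tensor_mul x (tensor_mul y z) = tensor_mul (tensor_mul x y) z.
Proof.
elim/tensor_ind: x => [|a b|x x' hx hx']; first by rewrite !tensor_mul0l.
  elim/tensor_ind: y => [|a' b'|y y' hy hy'].
  - by rewrite !(tensor_mul0l, tensor_mul0r).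
  - elim/tensor_ind: z => [|a'' b''|z z' hz hz'].
    + by rewrite !tensor_mul0r.
    + by rewrite !tensor_mul_pure !amulA.
    + by rewrite !tensor_mulDr hz hz'.
  - by rewrite !(tensor_mulDl, tensor_mulDr) hy hy'.
by rewrite !tensor_mulDl hx hx'.
Qed.

Lemma tensor_mul1l x : tensor_mul (aone ⊗ aone) x = x.
Proof.
elim/tensor_ind: x => [|a b|x y hx hy]; first exact: tensor_mul0r.
  by rewrite tensor_mul_pure !amul1l.
by rewrite tensor_mulDr hx hy.
Qed.

Lemma tensor_mul1r x : tensor_mul x (aone ⊗ aone) = x.
Proof.
elim/tensor_ind: x => [|a b|x y hx hy]; first exact: tensor_mul0l.
  by rewrite tensor_mul_pure !amul1r.
by rewrite tensor_mulDl hx hy.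
Qed.

Lemma tensor_mul_bilinear : bilinear_for *:%R *:%R tensor_mul.
Proof.
split=> [z|z] a x y /=; first by rewrite tensor_mulDl tensor_mulZl.
by rewrite tensor_mulDr tensor_mulZr.
Qed.

HB.instance Definition _ :=
  bilinear_isBilinear.Build K (A ⊗ B)%type (A ⊗ B)%type (A ⊗ B)%type
    *:%R *:%R tensor_mul tensor_mul_bilinear.

HB.instance Definition _ := Lmodule_isUAlgebra.Build K (A ⊗ B)%type
  tensor_mulA tensor_mul1l tensor_mul1r.

Lemma amul_pure (a a' : A) (b b' : B) :
  (a ⊗ b) ∙ (a' ⊗ b') = (a ∙ a') ⊗ (b ∙ b').
Proof. exact: tensor_mul_pure. Qed.

End TensorAlgebra.

HB.mixin Record Lmodule_isCoalgebra (K : fieldType) C of GRing.Lmodule K C := {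
  comul : {linear C -> (C ⊗ C)%type};
  counit : {scalar C};
  comulA : forall x : C,
    tmap comul idfun (comul x) = tassoc (tmap idfun comul (comul x));
  counitl : forall x : C, tlift (fun x1 x2 => counit x1 *: x2) (comul x) = x;
  counitr : forall x : C, tlift (fun x1 x2 => counit x2 *: x1) (comul x) = x
}.

#[short(type="coalgType")]
HB.structure Definition Coalgebra (K : fieldType) :=
  {C of GRing.Lmodule K C & Lmodule_isCoalgebra K C}.

Definition comul2 (K : fieldType) (C : coalgType K) (x : C) :
  (C ⊗ C ⊗ C)%type := tmap (@comul K C) idfun (comul x).

HB.mixin Record Coalgebra_isWeakBialgebra (K : fieldType) H
    of UAlgebra K H & Coalgebra K H := {
  comulM : forall x y : H, comul (x ∙ y) = comul x ∙ comul y;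
  counitM12 : forall x y z : H,
    counit (x ∙ y ∙ z) =
      tlift (fun y1 y2 => counit (x ∙ y1) * counit (y2 ∙ z)) (comul y);
  counitM21 : forall x y z : H,
    counit (x ∙ y ∙ z) =
      tlift (fun y1 y2 => counit (x ∙ y2) * counit (y1 ∙ z)) (comul y);
  comul2_1l :
    comul2 (aone : H) = (comul (aone : H) ⊗ (aone : H)) ∙ tassoc ((aone : H) ⊗ comul (aone : H));
  comul2_1r :
    comul2 (aone : H) = tassoc ((aone : H) ⊗ comul (aone : H)) ∙ (comul (aone : H) ⊗ (aone : H))
}.

#[short(type="weakBialgType")]
HB.structure Definition WeakBialgebra (K : fieldType) :=
  {H of UAlgebra K H & Coalgebra K H & Coalgebra_isWeakBialgebra K H}.

Definition PiL (K : fieldType) (H : weakBialgType K) (h : H) : H :=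
  tlift (fun e1 e2 => counit (e1 ∙ h) *: e2) (comul (aone : H)).

Definition PiR (K : fieldType) (H : weakBialgType K) (h : H) : H :=
  tlift (fun e1 e2 => counit (h ∙ e2) *: e1) (comul (aone : H)).

HB.mixin Record WeakBialgebra_isWeakHopf (K : fieldType) H
    of WeakBialgebra K H := {
  antipode : {linear H -> H};
  antipodeL : forall x : H,
    tlift (fun x1 x2 => x1 ∙ antipode x2) (comul x) = PiL x;
  antipodeR : forall x : H,
    tlift (fun x1 x2 => antipode x1 ∙ x2) (comul x) = PiR x;
  antipodeLR : forall x : H,
    tlift (fun t x3 => tlift (fun x1 x2 => antipode x1 ∙ x2) t ∙ antipode x3)
      (comul2 x) = antipode x
}.

#[short(type="weakHopfType")]
HB.structure Definition WeakHopf (K : fieldType) :=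
  {H of WeakBialgebra K H & WeakBialgebra_isWeakHopf K H}.

HB.mixin Record Lmodule_isComodule (K : fieldType) (C : coalgType K) M
    of GRing.Lmodule K M := {
  coact : {linear M -> (M ⊗ C)%type};
  coactA : forall m : M,
    tmap coact idfun (coact m) = tassoc (tmap idfun (@comul K C) (coact m));
  coact_counit : forall m : M,
    tlift (fun m0 m1 => counit m1 *: m0) (coact m) = m
}.

#[short(type="comodType")]
HB.structure Definition Comodule (K : fieldType) (C : coalgType K) :=
  {M of GRing.Lmodule K M & Lmodule_isComodule K C M}.

HB.mixin Record Comodule_isWeakComodAlgebra (K : fieldType)
    (H : weakBialgType K) A of UAlgebra K A & Comodule K H A := {
  coact1_PiL : forall a : A,
    coact (aone : A) ∙ (a ⊗ (aone : H)) = tmap idfun (@PiL K H) (coact a);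
  coactM : forall a b : A, coact (a ∙ b) = coact a ∙ coact b
}.

#[short(type="weakComodAlgType")]
HB.structure Definition WeakComodAlgebra (K : fieldType)
    (H : weakBialgType K) :=
  {A of UAlgebra K A & Comodule K H A & Comodule_isWeakComodAlgebra K H A}.

HB.mixin Record Lmodule_isRightModule (K : fieldType) (A : ualgType K) M
    of GRing.Lmodule K M := {
  ract : {bilinear M -> A -> M};
  ractA : forall (m : M) (a b : A), ract m (a ∙ b) = ract (ract m a) b;
  ract1 : forall m : M, ract m aone = m
}.

#[short(type="rightModType")]
HB.structure Definition RightModule (K : fieldType) (A : ualgType K) :=
  {M of GRing.Lmodule K M & Lmodule_isRightModule K A M}.

Notation "m ◁ a" := (ract m a) : ring_scope.

HB.mixin Record Comodule_isWeakDoiHopf (K : fieldType) (H : weakBialgType K)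
    (A : weakComodAlgType H) M of RightModule K A M & Comodule K H M := {
  coact_ract : forall (m : M) (a : A),
    coact (m ◁ a) =
      tlift (fun m0 m1 =>
        tlift (fun a0 a1 => (m0 ◁ a0) ⊗ (m1 ∙ a1)) (coact a)) (coact m)
}.

#[short(type="weakDoiHopfType")]
HB.structure Definition WeakDoiHopf (K : fieldType) (H : weakBialgType K)
    (A : weakComodAlgType H) :=
  {M of RightModule K A M & Comodule K H M & Comodule_isWeakDoiHopf K H A M}.

Definition weak_comod_alg_map (K : fieldType) (H : weakBialgType K)
    (A : weakComodAlgType H) (phi : {linear H -> A}) : Prop :=
  [/\ phi aone = aone,
      forall x y : H, phi (x ∙ y) = phi x ∙ phi y
    & forall h : H, coact (phi h) = tmap phi idfun (comul h)].

Definition rota_baxter_paired (K : fieldType) (A : ualgType K)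
    (M : rightModType A) (P : A -> A) (T : M -> M) (lambda : K) : Prop :=
  [/\ linear P, linear T
    & forall (a : A) (m : M),
        T m ◁ P a = T (m ◁ P a) + T (T m ◁ a) + lambda *: T (m ◁ a)].

Section E.
Variables (K : fieldType) (H : weakHopfType K) (A : weakComodAlgType H).

Definition E_alg (phi : H -> A) (a : A) : A :=
  tlift (fun (a0 : A) (a1 : H) => a0 ∙ phi (antipode a1)) (coact a).

Definition E_mod (M : weakDoiHopfType A) (phi : H -> A) (m : M) : M :=
  tlift (fun (m0 : M) (m1 : H) => m0 ◁ phi (antipode m1)) (coact m).

End E.

(* Main.v *)
Require Import Defs.
From HB Require Import structures.
From mathcomp Require Import all_boot all_order all_algebra.

(** Write [E] for both projections.  Multiplying [Δ(x_2) Δ(S x_3) = Δ(Π^L x_2)]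
    by [S x_1 ⊗ 1] on the left gives [S(x_2)_1 ⊗ x_1 S(x_2)_2 = S(x) 1_1 ⊗ 1_2],
    so [E(m)] is coinvariant: [ρ(E m) = E(m) φ(1_1) ⊗ 1_2].  Coinvariance yields
    [E(E(m) a) = E(m) E(a)], because [φ(1_1) ⊗ 1_2 = ρ(1_A)] is absorbed by
    [ρ(a)].  Applied to [E(a)] it also yields
    [E(m E(a)) = m_0 E(a) φ(1_1 S(m_1 1_2)) = m_0 E(a) φ(S m_1)], which equals
    [E(m a)] since [S] is antimultiplicative.  Hence two of the three terms on
    the right of the Rota-Baxter identity cancel. *)

Set Implicit Arguments.
Unset Strict Implicit.
Unset Printing Implicit Defensive.

Import GRing.Theory.
Local Open Scope ring_scope.

(* Sweedler notation [E x_1 x_2] for [t = Δ x]; [E] must be bilinear, as otherwise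
   the value depends on the representative chosen for [t]. *)
Reserved Notation "\sw_ ( x , y <- t ) E"
  (at level 41, x name, y name, t at level 50, E at level 41,
   format "'[' \sw_ ( x ,  y  <-  t ) '/  '  E ']'").
Notation "\sw_ ( x , y <- t ) E" := (tlift (fun x y => E) t) : ring_scope.

(** Unbundled, so that the anonymous bodies of Sweedler sums can be treated without giving each one
    a structure instance. *)
Definition is_linear {K : fieldType} {U V : lmodType K} (f : U -> V) : Prop :=
  forall a x y, f (a *: x + y) = a *: f x + f y.

Definition is_bilinear {K : fieldType} {U V W : lmodType K}
    (f : U -> V -> W) : Prop :=
  (forall v, is_linear (fun u => f u v)) /\ (forall u, is_linear (f u)).

Definition is_trilinear {K : fieldType} {U V W X : lmodType K}
    (f : U -> V -> W -> X) : Prop :=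
  [/\ forall v w, is_linear (fun u => f u v w),
      forall u w, is_linear (fun v => f u v w)
    & forall u v, is_linear (f u v)].

(** * Closure properties of linear maps and rules for Sweedler sums *)

Section Linearity.
Context {K : fieldType}.
Implicit Types U V W X : lmodType K.

Lemma is_linearD U V (f : U -> V) : is_linear f -> {morph f : x y / x + y}.
Proof. by move=> fl x y; rewrite -[x]scale1r fl !scale1r. Qed.

Lemma is_linear0 U V (f : U -> V) : is_linear f -> f 0 = 0.
Proof. by move=> /is_linearD fD; apply: (addrI (f 0)); rewrite -fD !addr0. Qed.

Lemma is_linearZ U V (f : U -> V) a x : is_linear f -> f (a *: x) = a *: f x.
Proof. by move=> fl; rewrite -[_ *: x]addr0 fl is_linear0 // addr0. Qed.

Lemma is_linear_id U : is_linear (fun x : U => x).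
Proof. by []. Qed.

Lemma is_linear_comp U V W (f : {linear V -> W}) (g : U -> V) :
  is_linear g -> is_linear (fun x => f (g x)).
Proof. by move=> gl a x y; rewrite gl linearP. Qed.

Lemma is_linear_compose U V W (f : V -> W) (g : U -> V) :
  is_linear f -> is_linear g -> is_linear (fun x => f (g x)).
Proof. by move=> fl gl a x y; rewrite gl fl. Qed.

Lemma is_linear_scalel U V (f : U -> K^o) (v : V) :
  is_linear f -> is_linear (fun x => f x *: v).
Proof. by move=> fl a x y; rewrite fl scalerDl scalerA. Qed.

Lemma is_linear_scaler U V (f : U -> V) (c : K) :
  is_linear f -> is_linear (fun x => c *: f x).
Proof. by move=> fl a x y; rewrite fl scalerDr !scalerA mulrC. Qed.

Lemma is_linear_purel U V W (f : U -> V) (w : W) :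
  is_linear f -> is_linear (fun x => f x ⊗ w).
Proof. by move=> fl a x y; rewrite fl pureDl pureZl. Qed.

Lemma is_linear_purer U V W (f : U -> V) (w : W) :
  is_linear f -> is_linear (fun x => w ⊗ f x).
Proof. by move=> fl a x y; rewrite fl pureDr pureZr. Qed.

Lemma is_linear_amull U (A : ualgType K) (f : U -> A) (b : A) :
  is_linear f -> is_linear (fun x => f x ∙ b).
Proof. by move=> fl a x y; rewrite fl amulDl amulZl. Qed.

Lemma is_linear_amulr U (A : ualgType K) (f : U -> A) (b : A) :
  is_linear f -> is_linear (fun x => b ∙ f x).
Proof. by move=> fl a x y; rewrite fl amulDr amulZr. Qed.

Lemma is_linear_ractl U (A : ualgType K) (M : rightModType A)
    (f : U -> M) (b : A) :
  is_linear f -> is_linear (fun x => f x ◁ b).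
Proof. by move=> fl a x y; rewrite fl linearDl linearZl_LR. Qed.

Lemma is_linear_ractr U (A : ualgType K) (M : rightModType A)
    (f : U -> A) (m : M) :
  is_linear f -> is_linear (fun x => m ◁ f x).
Proof. by move=> fl a x y; rewrite fl linearDr linearZr_LR. Qed.

Lemma is_linear_counit (C : coalgType K) :
  @is_linear K C K^o (@counit K C).
Proof. by move=> a x y; rewrite linearD linearZ. Qed.

Lemma bilinear_balanced U V W (f : U -> V -> W) :
  is_bilinear f -> balanced f.
Proof.
case=> fl fr; split=> *.
- exact: (is_linearD (fl _)).
- exact: (is_linearD (fr _)).
- by rewrite (is_linearZ _ _ (fl _)) (is_linearZ _ _ (fr _)).
Qed.

Lemma is_linear_tlift_tensor U V W X (f : V -> W -> X)
    (g : U -> (V ⊗ W)%type) :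
  is_bilinear f -> is_linear g -> is_linear (fun x => tlift f (g x)).
Proof.
move=> fb gl a x y; rewrite gl tliftD ?tliftZ //; try exact: bilinear_balanced.
by move=> u v; case: fb => fl _; rewrite (is_linearZ _ _ (fl _)).
Qed.

Lemma is_linear_tlift_fun U V W X (f : U -> V -> W -> X) (t : (V ⊗ W)%type) :
  (forall v w, is_linear (fun x => f x v w)) ->
  is_linear (fun x => tlift (f x) t).
Proof.
move=> fl a x y; rewrite (@tlift_additive _ _ _ _ _ _ ( *:%R a)); last first.
  exact: scalerDr.
by rewrite -tlift_addf; apply: eq_tlift => v w; rewrite fl.
Qed.

Lemma tlift_pure_bilinear U V W (f : U -> V -> W) u v :
  is_bilinear f -> tlift f (u ⊗ v) = f u v.
Proof. by move=> /bilinear_balanced/tlift_pure. Qed.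

Lemma tlift_linear U V W X (h : W -> X) (f : U -> V -> W) t :
  is_linear h -> h (tlift f t) = \sw_(u, v <- t) h (f u v).
Proof. by move=> /is_linearD/tlift_additive. Qed.

(** Each [tlift] is a finite sum over a fixed representative, so the two sums commute. *)
Lemma tlift_exchange U V U' V' W (f : U -> V -> U' -> V' -> W) s t :
  \sw_(u, v <- s) \sw_(u', v' <- t) f u v u' v' =
  \sw_(u', v' <- t) \sw_(u, v <- s) f u v u' v'.
Proof. exact: exchange_big. Qed.

Lemma tensor_linear_ext U V W (f g : (U ⊗ V)%type -> W) :
    is_linear f -> is_linear g -> (forall u v, f (u ⊗ v) = g (u ⊗ v)) ->
  f =1 g.
Proof.
move=> fl gl fg; elim/tensor_ind => [|u v|x y hx hy].
- by rewrite !is_linear0.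
- exact: fg.
- by rewrite !is_linearD // hx hy.
Qed.

End Linearity.

(** Descends through the body by its head symbol, trying the bound variable in either argument.
    [linearity_var] handles a local function whose linearity is a hypothesis. *)
Ltac linearity :=
  intros; cbv beta;
  lazymatch goal with
  | |- is_bilinear _ => split; linearity
  | |- is_trilinear _ => split; linearity
  | |- is_linear (fun x => x) => exact: is_linear_id
  | |- is_linear (fun x => _ *: _) =>
      first [apply: is_linear_scalel; linearity
            | apply: is_linear_scaler; linearity]
  | |- is_linear (fun x => _ ⊗ _) =>
      first [apply: is_linear_purel; linearity
            | apply: is_linear_purer; linearity]
  | |- is_linear (fun x => _ ∙ _) =>
      first [apply: is_linear_amull; linearity
            | apply: is_linear_amulr; linearity]
  | |- is_linear (fun x => _ ◁ _) =>
      first [apply: is_linear_ractl; linearity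
            | apply: is_linear_ractr; linearity]
  | |- is_linear (fun x => tlift _ _) =>
      first [apply: is_linear_tlift_tensor; linearity
            | apply: is_linear_tlift_fun; linearity]
  | |- is_linear (fun x => PiL _) => rewrite /PiL; linearity
  | |- is_linear (fun x => PiR _) => rewrite /PiR; linearity
  (* Also covers operations on a tensor product or a Doi-Hopf module, whose
     structure instances escape the syntactic patterns above. *)
  | |- is_linear (fun x => _) =>
      first [solve [eauto 2] | linearity_var
            | apply: (is_linear_compose (@is_linear_counit _ _)); linearity
            | apply: is_linear_amull; linearity
            | apply: is_linear_amulr; linearity
            | apply: is_linear_ractl; linearity
            | apply: is_linear_ractr; linearity
            | apply: is_linear_comp; linearity]
  | |- is_linear ?f =>
      first [solve [eauto 2] | exact: is_linear_counit
            | change (is_linear (fun x => f x)); linearity]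
  end
with linearity_var :=
  match goal with
  | |- is_linear (fun x => ?f (@?g x)) =>
      is_var f; apply: (is_linear_compose (f := f) (g := g))
  | |- is_linear (fun x => ?f (@?g x) ?b) =>
      is_var f; apply: (is_linear_compose (f := fun u => f u b) (g := g))
  | |- is_linear (fun x => ?f ?a (@?g x)) =>
      is_var f; apply: (is_linear_compose (f := fun u => f a u) (g := g))
  | |- is_linear (fun x => ?f (@?g x) ?b ?c) =>
      is_var f; apply: (is_linear_compose (f := fun u => f u b c) (g := g))
  | |- is_linear (fun x => ?f ?a (@?g x) ?c) =>
      is_var f; apply: (is_linear_compose (f := fun u => f a u c) (g := g))
  | |- is_linear (fun x => ?f ?a ?b (@?g x)) =>
      is_var f; apply: (is_linear_compose (f := fun u => f a b u) (g := g))
  end; [solve [eauto 2] | linearity].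

(** * Coassociativity and products of tensors in Sweedler form *)

Section Coassociativity.
Context {K : fieldType}.
Implicit Types U V W X : lmodType K.

Lemma tlift_assoc U V W X (g : (U ⊗ V)%type -> W -> X) t :
  is_bilinear g ->
  tlift g (tassoc t) = \sw_(u, s <- t) \sw_(v, w <- s) g (u ⊗ v) w.
Proof.
move=> gb; have gl := is_linear_tlift_tensor gb (@is_linear_id _ _).
case: (gb) => g1 g2.
have tl : is_linear (@tassoc K U V W) by rewrite /tassoc; linearity.
move: t; apply: tensor_linear_ext.
- by move=> a x y; rewrite tl gl.
- linearity.
move=> u s; rewrite tlift_pure_bilinear; last linearity.
move: s; apply: tensor_linear_ext.
- by move=> a x y; rewrite pureDr pureZr tl gl.
- linearity.
by move=> v w; rewrite tassoc_pure !tlift_pure_bilinear //; linearity.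
Qed.

Lemma tlift_tmap U V U' V' W (g : {linear U -> U'}) (h : {linear V -> V'})
    (f : U' -> V' -> W) t :
  is_bilinear f -> tlift f (tmap g h t) = \sw_(u, v <- t) f (g u) (h v).
Proof.
move=> fb; case: (fb) => f1 f2.
rewrite /tmap tlift_linear; last linearity.
by apply: eq_tlift => u v; rewrite tlift_pure_bilinear.
Qed.

(** Stated for arbitrary [g] and [d] to serve both the comultiplication of [H] and the coaction on a
    comodule. *)
Lemma tlift_coassoc U V W (g : {linear U -> (U ⊗ V)%type})
    (d : {linear V -> (V ⊗ V)%type}) (t : (U ⊗ V)%type)
    (f : U -> V -> V -> W) :
    tmap g idfun t = tassoc (tmap idfun d t) -> is_trilinear f ->
  \sw_(u, v <- t) \sw_(u0, u1 <- g u) f u0 u1 v =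
  \sw_(u, v <- t) \sw_(v1, v2 <- d v) f u v1 v2.
Proof.
(* Apply to the hypothesis the linear map on [U ⊗ V ⊗ V] induced by [f]. *)
move=> /(congr1 (tlift (fun s w => \sw_(u, v <- s) f u v w))) e [f1 f2 f3].
move: e; rewrite tlift_tmap; last linearity.
rewrite tlift_assoc; last linearity.
rewrite tlift_tmap; last linearity.
move=> ->; do 2! apply: eq_tlift => ? ?; rewrite tlift_pure_bilinear //; linearity.
Qed.

End Coassociativity.

Section TensorProducts.
Context {K : fieldType}.

Lemma tlift_amul (A B : ualgType K) (W : lmodType K) (f : A -> B -> W)
    (s t : (A ⊗ B)%type) :
  is_bilinear f ->
  tlift f (s ∙ t) =
  \sw_(a, b <- s) \sw_(a', b' <- t) f (a ∙ a') (b ∙ b').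
Proof.
case=> f1 f2; move: s; apply: tensor_linear_ext; [linearity..|move=> a b].
rewrite tlift_pure_bilinear; last linearity.
move: t; apply: tensor_linear_ext; [linearity..|move=> a' b'].
by rewrite amul_pure !tlift_pure_bilinear //; linearity.
Qed.

End TensorProducts.

(** * Identities for [Δ(1)], [Π^L] and [Π^R] in a weak bialgebra *)

Section WeakBialgebraTheory.
Context {K : fieldType} {H : weakBialgType K}.
Implicit Types (x y z : H) (W : lmodType K).

Lemma tlift_comulA W (f : H -> H -> H -> W) x :
  is_trilinear f ->
  \sw_(x1, x2 <- comul x) \sw_(y1, y2 <- comul x1) f y1 y2 x2 =
  \sw_(x1, x2 <- comul x) \sw_(y1, y2 <- comul x2) f x1 y1 y2.
Proof. exact/tlift_coassoc/comulA. Qed.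

Lemma tlift_comulM W (f : H -> H -> W) x y :
  is_bilinear f ->
  tlift f (comul (x ∙ y)) =
  \sw_(x1, x2 <- comul x) \sw_(y1, y2 <- comul y) f (x1 ∙ y1) (x2 ∙ y2).
Proof. by move=> fb; rewrite comulM tlift_amul. Qed.

Lemma tlift_comul_mul1 W (f : H -> H -> W) x :
  is_bilinear f ->
  \sw_(x1, x2 <- comul x) \sw_(e1, e2 <- comul (aone : H))
    f (x1 ∙ e1) (x2 ∙ e2) = tlift f (comul x).
Proof. by move=> fb; rewrite -tlift_comulM // amul1r. Qed.

Lemma tlift_comul_1mul W (f : H -> H -> W) x :
  is_bilinear f ->
  \sw_(e1, e2 <- comul (aone : H)) \sw_(x1, x2 <- comul x)
    f (e1 ∙ x1) (e2 ∙ x2) = tlift f (comul x).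
Proof. by move=> fb; rewrite -tlift_comulM // amul1l. Qed.

Lemma tlift_comul2 W (f : H -> H -> H -> W) x :
  is_trilinear f ->
  \sw_(s, x3 <- comul2 x) \sw_(x1, x2 <- s) f x1 x2 x3 =
  \sw_(x1, x2 <- comul x) \sw_(y1, y2 <- comul x2) f x1 y1 y2.
Proof.
move=> ft; rewrite -tlift_comulA //; case: ft => f1 f2 f3.
by rewrite /comul2 tlift_tmap //; linearity.
Qed.

Lemma tlift_comul2_1l W (f : H -> H -> H -> W) :
  is_trilinear f ->
  \sw_(e1, e2 <- comul (aone : H)) \sw_(d1, d2 <- comul e2) f e1 d1 d2 =
  \sw_(e1, e2 <- comul (aone : H)) \sw_(d1, d2 <- comul (aone : H))
    f e1 (e2 ∙ d1) d2.
Proof.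
move=> ft; rewrite -tlift_comul2 //; case: ft => f1 f2 f3.
rewrite comul2_1l tlift_amul; last linearity.
rewrite tlift_pure_bilinear; last linearity.
rewrite tlift_assoc; last linearity.
rewrite tlift_pure_bilinear; last linearity.
rewrite tlift_exchange; apply: eq_tlift => d1 d2.
rewrite tlift_amul; last linearity.
apply: eq_tlift => e1 e2; rewrite tlift_pure_bilinear; last linearity.
by rewrite amul1l amul1r.
Qed.

Lemma tlift_comul2_1r W (f : H -> H -> H -> W) :
  is_trilinear f ->
  \sw_(e1, e2 <- comul (aone : H)) \sw_(d1, d2 <- comul e2) f e1 d1 d2 =
  \sw_(e1, e2 <- comul (aone : H)) \sw_(d1, d2 <- comul (aone : H))
    f e1 (d1 ∙ e2) d2.
Proof.
move=> ft; rewrite -tlift_comul2 //; case: ft => f1 f2 f3.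
rewrite comul2_1r tlift_amul; last linearity.
rewrite tlift_assoc; last linearity.
rewrite tlift_pure_bilinear; last linearity.
rewrite [RHS]tlift_exchange; apply: eq_tlift => d1 d2.
rewrite tlift_pure_bilinear; last linearity.
rewrite tlift_amul; last linearity.
rewrite tlift_pure_bilinear; last linearity.
by apply: eq_tlift => e1 e2; rewrite amul1l amul1r.
Qed.

(** Replacing [Δ(x)] by [Δ(x)Δ(1)] turns [ε(x_1 1_2) 1_1 ⊗ x_2] into
    [ε(x_1 1'_1 1_2) 1_1 ⊗ x_2 1'_2]. By the axiom on [Δ^2(1)] this is [ε(x_1 1_2) 1_1 ⊗ x_2 1_3],
    and the counit contracts it to [1_1 ⊗ x 1_2]. *)
Lemma tlift_PiR W (f : H -> H -> W) x :
  is_bilinear f ->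
  \sw_(x1, x2 <- comul x) f (PiR x1) x2 =
  \sw_(e1, e2 <- comul (aone : H)) f e1 (x ∙ e2).
Proof.
case=> fl fr; transitivity (\sw_(e1, e2 <- comul (aone : H))
  \sw_(x1, x2 <- comul x) counit (x1 ∙ e2) *: f e1 x2).
  rewrite tlift_exchange; apply: eq_tlift => x1 x2.
  rewrite /PiR (tlift_linear (h := fun u => f u x2)); last linearity.
  by apply: eq_tlift => e1 e2; rewrite (is_linearZ _ _ (fl _)).
transitivity (\sw_(e1, e2 <- comul (aone : H)) \sw_(d1, d2 <- comul (aone : H))
  \sw_(x1, x2 <- comul x) counit (x1 ∙ (d1 ∙ e2)) *: f e1 (x2 ∙ d2)).
  apply: eq_tlift => e1 e2; rewrite -tlift_comul_mul1; last linearity.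
  by rewrite tlift_exchange; do 2! apply: eq_tlift => ? ?; rewrite amulA.
rewrite -(tlift_comul2_1r (f := fun a b c => \sw_(x1, x2 <- comul x)
  counit (x1 ∙ b) *: f a (x2 ∙ c))); last linearity.
apply: eq_tlift => e1 e2; rewrite -[in RHS](counitl (x ∙ e2)).
rewrite tlift_comulM; last linearity.
rewrite (tlift_linear (h := f e1)); last linearity.
rewrite tlift_exchange; apply: eq_tlift => x1 x2.
rewrite (tlift_linear (h := f e1)); last linearity.
by apply: eq_tlift => d1 d2; rewrite (is_linearZ _ _ (fr _)).
Qed.

Lemma tlift_comul_PiL W (f : H -> H -> W) y :
  is_bilinear f ->
  tlift f (comul (PiL y)) =
  \sw_(e1, e2 <- comul (aone : H)) \sw_(d1, d2 <- comul e2)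
    counit (e1 ∙ y) *: f d1 d2.
Proof.
case=> fl fr; rewrite /PiL.
rewrite (tlift_linear (h := fun z => tlift f (comul z))); last linearity.
apply: eq_tlift => e1 e2; rewrite linearZ /=.
rewrite (is_linearZ (f := tlift f)); last linearity.
by rewrite (tlift_linear (h := fun z : W => counit (e1 ∙ y) *: z)) //; linearity.
Qed.

(** [Δ(Π^L y) = ε(1_1 y) 1_2 ⊗ 1_3 = ε(1_1 y) 1_2 1'_1 ⊗ 1'_2], where [Π^L(y)] splits off. The
    opposite order of factors in [Δ^2(1)] gives [tlift_comul_PiLr]. *)
Lemma tlift_comul_PiLl W (f : H -> H -> W) y :
  is_bilinear f ->
  tlift f (comul (PiL y)) =
  \sw_(e1, e2 <- comul (aone : H)) f (PiL y ∙ e1) e2.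
Proof.
move=> fb; case: (fb) => fl fr; rewrite tlift_comul_PiL // /PiL.
rewrite tlift_comul2_1l; last linearity.
rewrite tlift_exchange; apply: eq_tlift => d1 d2.
rewrite (tlift_linear (h := fun z => f (z ∙ d1) d2)); last linearity.
by apply: eq_tlift => e1 e2; rewrite amulZl (is_linearZ _ _ (fl _)).
Qed.

Lemma tlift_comul_PiLr W (f : H -> H -> W) y :
  is_bilinear f ->
  tlift f (comul (PiL y)) =
  \sw_(e1, e2 <- comul (aone : H)) f (e1 ∙ PiL y) e2.
Proof.
move=> fb; case: (fb) => fl fr; rewrite tlift_comul_PiL // /PiL.
rewrite tlift_comul2_1r; last linearity.
rewrite tlift_exchange; apply: eq_tlift => d1 d2.
rewrite (tlift_linear (h := fun z => f (d1 ∙ z) d2)); last linearity.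
by apply: eq_tlift => e1 e2; rewrite amulZr (is_linearZ _ _ (fl _)).
Qed.

(** Apply [id ⊗ ε(x -)] to [(Π^L(y) ⊗ 1)Δ(1) = Δ(Π^L y) = Δ(1)(Π^L(y) ⊗ 1)]. *)
Lemma PiL_PiR_comm x y : PiL y ∙ PiR x = PiR x ∙ PiL y.
Proof.
have E z (h : H -> H) : is_linear h -> h (PiR z) =
    \sw_(e1, e2 <- comul (aone : H)) counit (z ∙ e2) *: h e1.
  move=> hl; rewrite /PiR tlift_linear //.
  by apply: eq_tlift => e1 e2; rewrite (is_linearZ _ _ hl).
rewrite (E x (fun z => PiL y ∙ z)); last linearity.
rewrite (E x (fun z => z ∙ PiL y)); last linearity.
rewrite -(tlift_comul_PiLl (W := H) (f := fun a b => counit (x ∙ b) *: a)); last linearity.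
by rewrite tlift_comul_PiLr //; linearity.
Qed.

Lemma counit_mul_PiL x y : counit (x ∙ PiL y) = counit (x ∙ y).
Proof.
(* [ε(x 1 y) = ε(x 1_2) ε(1_1 y)]. *)
rewrite -[in RHS](amul1r x) counitM21 /PiL.
rewrite (tlift_linear (X := K^o) (h := fun z => counit (x ∙ z))); last linearity.
apply: eq_tlift => e1 e2; rewrite amulZr linearZ /=.
by rewrite mulrC.
Qed.

Lemma PiL_mul_PiL x y : PiL (x ∙ PiL y) = PiL (x ∙ y).
Proof.
by apply: eq_tlift => e1 e2; rewrite !amulA counit_mul_PiL.
Qed.

End WeakBialgebraTheory.

(** * The antipode: antimultiplicativity and its comultiplication *)

Section WeakHopfTheory.
Context {K : fieldType} {H : weakHopfType K}.
Implicit Types (x y z h : H) (W : lmodType K).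

Lemma PiR_antipode x :
  \sw_(x1, x2 <- comul x) (PiR x1 ∙ antipode x2) = antipode x.
Proof.
rewrite -antipodeLR /comul2 tlift_tmap; last linearity.
by apply: eq_tlift => x1 x2; rewrite antipodeR.
Qed.

(** Group the last two factors of [S(x_1) x_2 S(x_3)] instead of the first two. *)
Lemma antipode_PiL x :
  \sw_(x1, x2 <- comul x) (antipode x1 ∙ PiL x2) = antipode x.
Proof.
rewrite -[RHS]PiR_antipode.
transitivity (\sw_(x1, x2 <- comul x) \sw_(y1, y2 <- comul x2)
  (antipode x1 ∙ y1 ∙ antipode y2)).
  apply: eq_tlift => x1 x2; rewrite -antipodeL.
  rewrite (tlift_linear (h := amul (antipode x1))); last linearity.
  by apply: eq_tlift => y1 y2; rewrite amulA.
rewrite -tlift_comulA; last linearity.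
apply: eq_tlift => x1 x2; rewrite -antipodeR.
by rewrite (tlift_linear (h := fun z => z ∙ antipode x2)) //; linearity.
Qed.

Lemma mul1_antipode x :
  \sw_(e1, e2 <- comul (aone : H)) (e1 ∙ antipode (x ∙ e2)) = antipode x.
Proof.
by rewrite -(tlift_PiR (f := fun a b => a ∙ antipode b)) ?PiR_antipode //; linearity.
Qed.

(** [Π^L(xy) = Π^L(x Π^L(y))], and by [tlift_comul_PiLr] the latter is [x_1 1_1 Π^L(y) S(x_2 1_2)],
    where [Δ(1)] is absorbed by [Δ(x)]. *)
Lemma adjoint_PiL x y :
  \sw_(x1, x2 <- comul x) (x1 ∙ PiL y ∙ antipode x2) = PiL (x ∙ y).
Proof.
rewrite -PiL_mul_PiL -[RHS]antipodeL tlift_comulM; last linearity.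
transitivity (\sw_(x1, x2 <- comul x) \sw_(e1, e2 <- comul (aone : H))
  (x1 ∙ e1 ∙ PiL y ∙ antipode (x2 ∙ e2))).
  by rewrite (tlift_comul_mul1 (f := fun a b => a ∙ PiL y ∙ antipode b)) //; linearity.
apply: eq_tlift => x1 x2; rewrite tlift_comul_PiLr; last linearity.
by apply: eq_tlift => e1 e2; rewrite !amulA.
Qed.

(* Expand [Π^R(x_1) h_1 S(x_2 h_2)] in two ways: by [Π^R(x_1) ⊗ x_2 = 1_1 ⊗ x 1_2],
   and as [S(x_1) Π^L(x_2 h) = Π^R(x_1) Π^L(h) S(x_2)]. *)
Lemma mul_antipode_mul x h :
  \sw_(h1, h2 <- comul h) (h1 ∙ antipode (x ∙ h2)) = PiL h ∙ antipode x.
Proof.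
transitivity (\sw_(x1, x2 <- comul x) \sw_(h1, h2 <- comul h)
  (PiR x1 ∙ (h1 ∙ antipode (x2 ∙ h2)))).
  rewrite (tlift_PiR (f := fun a b => \sw_(h1, h2 <- comul h)
    (a ∙ (h1 ∙ antipode (b ∙ h2))))); last linearity.
  rewrite -(tlift_comul_1mul (f := fun a b => a ∙ antipode (x ∙ b))); last linearity.
  by do 2! apply: eq_tlift => ? ?; rewrite !amulA.
transitivity (\sw_(x1, x2 <- comul x) (antipode x1 ∙ PiL (x2 ∙ h))).
  transitivity (\sw_(x1, x2 <- comul x) \sw_(y1, y2 <- comul x1)
    \sw_(h1, h2 <- comul h) (antipode y1 ∙ (y2 ∙ h1 ∙ antipode (x2 ∙ h2)))).
    apply: eq_tlift => x1 x2; rewrite -antipodeR.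
    rewrite (tlift_linear (h := fun z => \sw_(h1, h2 <- comul h)
       (z ∙ (h1 ∙ antipode (x2 ∙ h2))))); last linearity.
    by do 2! apply: eq_tlift => ? ?; rewrite !amulA.
  rewrite tlift_comulA; last linearity.
  apply: eq_tlift => x1 x2; rewrite -antipodeL tlift_comulM; last linearity.
  rewrite (tlift_linear (h := amul (antipode x1))); last linearity.
  apply: eq_tlift => y1 y2.
  by rewrite (tlift_linear (h := amul (antipode x1))) //; linearity.
transitivity (\sw_(x1, x2 <- comul x) \sw_(y1, y2 <- comul x2)
  (antipode x1 ∙ (y1 ∙ PiL h ∙ antipode y2))).
  apply: eq_tlift => x1 x2; rewrite -adjoint_PiL.
  by rewrite (tlift_linear (h := amul (antipode x1))) //; linearity.
rewrite -tlift_comulA; last linearity.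
rewrite -PiR_antipode (tlift_linear (h := amul (PiL h))); last linearity.
(* [Π^L(h)] must pass [Π^R(x_1)] before the latter is expanded. *)
apply: eq_tlift => x1 x2; rewrite amulA PiL_PiR_comm -antipodeR.
rewrite (tlift_linear (h := fun z => z ∙ PiL h ∙ antipode x2)); last linearity.
by apply: eq_tlift => y1 y2; rewrite !amulA.
Qed.

(* Expand [S(h_1) h_2 S(x h_3)] in two ways. *)
Lemma antipodeM x h : antipode (x ∙ h) = antipode h ∙ antipode x.
Proof.
(* The first grouping is [1_1 S(x h 1_2) = S(x h)]. *)
transitivity (\sw_(h1, h2 <- comul h) (PiR h1 ∙ antipode (x ∙ h2))).
  rewrite (tlift_PiR (f := fun a b => a ∙ antipode (x ∙ b))); last linearity.
  by rewrite -mul1_antipode; apply: eq_tlift => e1 e2; rewrite amulA.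
transitivity (\sw_(h1, h2 <- comul h) \sw_(y1, y2 <- comul h1)
  (antipode y1 ∙ (y2 ∙ antipode (x ∙ h2)))).
  apply: eq_tlift => h1 h2; rewrite -antipodeR.
  rewrite (tlift_linear (h := fun z => z ∙ antipode (x ∙ h2))); last linearity.
  by apply: eq_tlift => y1 y2; rewrite amulA.
rewrite tlift_comulA; last linearity.
(* The second grouping is [S(h_1) Π^L(h_2) S(x)], by [mul_antipode_mul]. *)
rewrite -[in RHS]antipode_PiL.
rewrite (tlift_linear (h := fun z => z ∙ antipode x)); last linearity.
apply: eq_tlift => h1 h2; rewrite -amulA -mul_antipode_mul.
by rewrite (tlift_linear (h := amul (antipode h1))) //; linearity.
Qed.

(* Both sides are [(S(x_1) ⊗ 1) Δ(x_2) Δ(S x_3)]: it is [(Π^R(x_1) ⊗ x_2) Δ(S x_3)]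
   on the left and [(S(x_1) ⊗ 1) Δ(Π^L x_2)] on the right. *)
Lemma tlift_comul_antipode W (f : H -> H -> W) x :
  is_bilinear f ->
  \sw_(x1, x2 <- comul x) \sw_(a, b <- comul (antipode x2)) f a (x1 ∙ b) =
  \sw_(e1, e2 <- comul (aone : H)) f (antipode x ∙ e1) e2.
Proof.
case=> fl fr; symmetry.
transitivity (\sw_(x1, x2 <- comul x) \sw_(e1, e2 <- comul (aone : H))
  f (antipode x1 ∙ (PiL x2 ∙ e1)) e2).
  rewrite -[in LHS]antipode_PiL tlift_exchange; apply: eq_tlift => e1 e2.
  rewrite (tlift_linear (h := fun z => f (z ∙ e1) e2)); last linearity.
  by apply: eq_tlift => ? ?; rewrite amulA.
transitivity (\sw_(x1, x2 <- comul x) \sw_(y1, y2 <- comul x2)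
  \sw_(c, d <- comul y1) \sw_(a, b <- comul (antipode y2))
    f (antipode x1 ∙ c ∙ a) (d ∙ b)).
  apply: eq_tlift => x1 x2.
  rewrite -(tlift_comul_PiLl (f := fun u v => f (antipode x1 ∙ u) v)); last linearity.
  rewrite -antipodeL.
  rewrite (tlift_linear (h := fun z =>
    \sw_(u, v <- comul z) f (antipode x1 ∙ u) v)); last linearity.
  apply: eq_tlift => y1 y2; rewrite tlift_comulM; last linearity.
  by do 2! apply: eq_tlift => ? ?; rewrite amulA.
rewrite -tlift_comulA; last linearity.
apply: eq_tlift => x1 x2; rewrite -tlift_comulA; last linearity.
transitivity (\sw_(y1, y2 <- comul x1) \sw_(a, b <- comul (antipode x2))
  f (PiR y1 ∙ a) (y2 ∙ b)).
  apply: eq_tlift => y1 y2; rewrite -antipodeR.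
  by rewrite (tlift_linear (h := fun z => \sw_(a, b <- comul (antipode x2))
    f (z ∙ a) (y2 ∙ b))) //; linearity.
rewrite (tlift_PiR (f := fun u v => \sw_(a, b <- comul (antipode x2))
    f (u ∙ a) (v ∙ b))); last linearity.
(* The remaining [Δ(1)] is absorbed by [Δ(S x_2)]. *)
rewrite -(tlift_comul_1mul (f := fun a b => f a (x1 ∙ b))); last linearity.
by do 2! apply: eq_tlift => ? ?; rewrite amulA.
Qed.

End WeakHopfTheory.

(** * Coinvariance of the projection and its consequences *)

Section ProjectionOntoCoinvariants.
Context {K : fieldType} {H : weakHopfType K} {A : weakComodAlgType H}.
Context {phi : {linear H -> A}} (phi_map : weak_comod_alg_map phi).
Context {M : weakDoiHopfType A}.
Implicit Types (a : A) (m : M) (W : lmodType K).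

Lemma E_mod_linear : is_linear (E_mod phi : M -> M).
Proof. rewrite /E_mod; linearity. Qed.

Lemma tlift_coact_ract W (f : M -> H -> W) m a :
  is_bilinear f ->
  tlift f (coact (m ◁ a)) =
  \sw_(m0, m1 <- coact m) \sw_(a0, a1 <- coact a) f (m0 ◁ a0) (m1 ∙ a1).
Proof.
move=> fb; case: (fb) => f1 f2; rewrite coact_ract.
rewrite (tlift_linear (h := tlift f)); last linearity.
apply: eq_tlift => m0 m1.
rewrite (tlift_linear (h := tlift f)); last linearity.
by apply: eq_tlift => a0 a1; rewrite tlift_pure_bilinear.
Qed.

Lemma tlift_coact_map W (f : A -> H -> W) h :
  is_bilinear f ->
  tlift f (coact (phi h)) = \sw_(h1, h2 <- comul h) f (phi h1) h2.
Proof. by case: phi_map => _ _ -> fb; rewrite tlift_tmap. Qed.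

(** Since [φ] is a comodule map, [ρ(E m) = m_0 φ(S(m_2)_1) ⊗ m_1 S(m_2)_2]; then
    [tlift_comul_antipode] applies with [x = m_1]. *)
Lemma tlift_coact_E_mod W (f : M -> H -> W) m :
  is_bilinear f ->
  tlift f (coact (E_mod phi m)) =
  \sw_(e1, e2 <- comul (aone : H)) f (E_mod phi m ◁ phi e1) e2.
Proof.
case: (phi_map) => _ phiM _ fb; case: (fb) => f1 f2.
transitivity (\sw_(m0, m1 <- coact m) \sw_(x1, x2 <- comul m1)
  \sw_(a, b <- comul (antipode x2)) f (m0 ◁ phi a) (x1 ∙ b)).
  rewrite (tlift_linear (h := fun z => tlift f (coact z))); last linearity.
  rewrite -(tlift_coassoc (f := fun u x1 x2 => \sw_(a, b <- comul (antipode x2))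
    f (u ◁ phi a) (x1 ∙ b)) (coactA m)); last linearity.
  apply: eq_tlift => m0 m1; rewrite tlift_coact_ract //.
  by apply: eq_tlift => u v; rewrite tlift_coact_map //; linearity.
transitivity (\sw_(m0, m1 <- coact m) \sw_(e1, e2 <- comul (aone : H))
  f (m0 ◁ phi (antipode m1 ∙ e1)) e2).
  apply: eq_tlift => m0 m1.
  by rewrite (tlift_comul_antipode (f := fun u v => f (m0 ◁ phi u) v)) //; linearity.
rewrite tlift_exchange; apply: eq_tlift => e1 e2.
rewrite (tlift_linear (h := fun z => f (z ◁ phi e1) e2)); last linearity.
by apply: eq_tlift => m0 m1; rewrite phiM ractA.
Qed.

(** In [m_0 a_0 φ(S(m_1 a_1))] antimultiplicativity of [S] brings [φ(S a_1)] next to [a_0]. *)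
Lemma E_mod_ract m a :
  E_mod phi (m ◁ a) =
  \sw_(m0, m1 <- coact m) (m0 ◁ (E_alg phi a ∙ phi (antipode m1))).
Proof.
case: (phi_map) => _ phiM _.
rewrite {1}/E_mod tlift_coact_ract; last linearity.
apply: eq_tlift => m0 m1.
rewrite (tlift_linear (h := fun z => m0 ◁ (z ∙ phi (antipode m1)))); last linearity.
by apply: eq_tlift => a0 a1; rewrite antipodeM phiM !ractA.
Qed.

Lemma E_mod_E_mod_ract m a :
  E_mod phi (E_mod phi m ◁ a) = E_mod phi m ◁ E_alg phi a.
Proof.
case: (phi_map) => phi1 phiM _.
rewrite {1}/E_mod tlift_coact_ract; last linearity.
rewrite tlift_coact_E_mod; last linearity.
(* Writing [a] as [φ(1) a] produces in [ρ(a)] the factor [φ(1_1) ⊗ 1_2] that coinvariance gives on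
   the left. *)
rewrite -[in RHS](amul1l a) -phi1 /E_alg coactM tlift_amul; last linearity.
rewrite (tlift_coact_map (f := fun u v => \sw_(a0, a1 <- coact a)
  (u ∙ a0 ∙ phi (antipode (v ∙ a1))))); last linearity.
rewrite (tlift_linear (h := ract (E_mod phi m))); last linearity.
apply: eq_tlift => e1 e2.
rewrite (tlift_linear (h := ract (E_mod phi m))); last linearity.
by apply: eq_tlift => a0 a1; rewrite !ractA.
Qed.

End ProjectionOntoCoinvariants.

(* [A] as a Doi-Hopf module over itself; there [E_mod] is [E_alg]. *)
Definition regular_mod {K : fieldType} {H : weakBialgType K}
  (A : weakComodAlgType H) : Type := A.

Section RegularModule.
Context {K : fieldType} {H : weakBialgType K} {A : weakComodAlgType H}.

HB.instance Definition _ := Comodule.on (regular_mod A).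

HB.instance Definition _ := Lmodule_isRightModule.Build K A (regular_mod A)
  (@amulA K A) (@amul1r K A).

(** The product of [A ⊗ H] unfolds to the nested [tlift] of [coact_ract], so [coactM] is the
    required law. *)
HB.instance Definition _ := Comodule_isWeakDoiHopf.Build K H A (regular_mod A)
  (@coactM K H A).

End RegularModule.

(** * The Rota-Baxter identity *)

Lemma E_mod_E_alg {K : fieldType} {H : weakHopfType K} {A : weakComodAlgType H}
    (phi : {linear H -> A}) (M : weakDoiHopfType A) (m : M) a :
  weak_comod_alg_map phi ->
  E_mod phi (m ◁ E_alg phi a) = E_mod phi (m ◁ a).
Proof.
move=> phi_map; rewrite [RHS](E_mod_ract phi_map).
rewrite /E_mod tlift_coact_ract; last linearity.
apply: eq_tlift => m0 m1.
(* [E_alg] is convertible to [E_mod] on the regular module, so [E(a)] is coinvariant. *)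
rewrite (tlift_coact_E_mod phi_map (M := regular_mod A)
  (f := fun u v => (m0 ◁ u) ◁ phi (antipode (m1 ∙ v)))); last linearity.
(* On the right, [S(m_1)] becomes [1_1 S(m_1 1_2)], the shape given by coinvariance. *)
rewrite -mul1_antipode.
rewrite (tlift_linear (h := fun z => m0 ◁ (E_alg phi a ∙ phi z))); last linearity.
case: phi_map => _ phiM _.
by apply: eq_tlift => e1 e2; rewrite phiM !ractA.
Qed.

Theorem theorem3p15 (K : fieldType) (H : weakHopfType K)
    (A : weakComodAlgType H) (phi : {linear H -> A})
    (hphi : weak_comod_alg_map phi) (M : weakDoiHopfType A) :
  rota_baxter_paired (E_alg phi) (E_mod (M := M) phi) (-1).
Proof.
split=> [||a m]; [exact: (E_mod_linear (M := regular_mod A)) | exact: E_mod_linear |].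
rewrite E_mod_E_alg // E_mod_E_mod_ract // scaleN1r.
by rewrite addrAC subrr add0r.
Qed.
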